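(* There is an absolute constant $C>0$ such that for every integer $n\geq 3$, with $N=2^n-1$ and $R=\mathbb{Z}/N\mathbb{Z}$, and every $w\in W=\{0,\ldots,n-1\}$, \[ \sum_{t\in R,\ t\neq 0}\left|\widehat{S_w}(t)\right|^4\leq C\,n^{-3}. \] Equivalently, with an absolute implied constant (uniform in $n\geq 3$ and $w\in W$), \[ E(S_w)=\frac{1}{N}\binom{n}{w}^4+O\left(N^3n^{-3}\right). \]
   Context: For an integer $n\geq 3$ put $N=2^n-1$, $R=\mathbb{Z}/N\mathbb{Z}$ (neither $n$ nor $N$ is assumed prime), and $W=\{0,\ldots,n-1\}$. Each residue in $R$ is identified with its representative in $\{0,\ldots,2^n-2\}$, and $\mathrm{wt}(x)$ denotes the number of ones in the $n$-digit binary expansion of that representative. For $w\in W$, $S_w=\{x\in R:\mathrm{wt}(x)=w\}$, so $|S_w|=\binom{n}{w}$. The Fourier transform is normalized as \[ \widehat{S_w}(t)=\frac1N\sum_{x\in S_w}\exp\left(-\frac{2\pi i\,xt}{N}\right),\qquad t\in R. \] For $A\subseteq R$, the additive energy is $E(A)=\left|\{(a,b,c,d)\in A^4: a+b=c+d\}\right|$, with addition in $R$. *)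

(* Defs.v *)
From mathcomp Require Import all_boot all_order all_algebra.
From mathcomp Require Import reals sequences exp trigo.
From mathcomp Require Import complex.

Set Implicit Arguments.
Unset Strict Implicit.
Unset Printing Implicit Defensive.

Import Order.TTheory GRing.Theory Num.Theory.
Local Open Scope ring_scope.
Local Open Scope complex_scope.

(* Modulus of a complex number as an element of the real field; the norm
   `|z| on R[i] is itself valued in R[i], and equals (cmod z)%:C. *)
Notation cmod := ComplexField.Normc.normc.

Definition cexp (R : realType) (z : R[i]) : R[i] :=
  (expR (complex.Re z))%:C * (cos (complex.Im z) +i* sin (complex.Im z)).

Definition mersenne (n : nat) : nat := (2 ^ n - 1)%N.

(* 'Z_N is the ring of integers modulo N only for N > 1, that is n > 1 below;
   the coercion 'Z_N >-> nat is then the representative in {0, ..., N - 1}. *)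
Notation Zmersenne n := 'Z_(mersenne n).

(* Number of ones among the n lowest binary digits of x *)
Definition wt (n x : nat) : nat := (\sum_(i < n) (x %/ 2 ^ i) %% 2)%N.

Definition weight_class (n w : nat) : {set Zmersenne n} :=
  [set x : Zmersenne n | wt n x == w].

Definition fourier (R : realType) (N : nat) (A : {set 'Z_N}) (t : 'Z_N) : R[i] :=
  N%:R^-1 *
  \sum_(x in A)
    cexp (- ((2 * pi)%:C * 'i * (nat_of_ord x)%:R * (nat_of_ord t)%:R / N%:R)).

Definition energy (G : finZmodType) (A : {set G}) : nat :=
  #|[set q : G * G * G * G |
      let: (a, b, c, d) := q in
      [&& a \in A, b \in A, c \in A, d \in A & a + b == c + d]]|.

(* Main.v *)
Require Import Defs.
From mathcomp Require Import all_boot all_order all_algebra.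
From mathcomp Require Import reals sequences exp trigo.
From mathcomp Require Import complex.
From mathcomp Require Import ring lra zify.

Set Implicit Arguments.
Unset Strict Implicit.
Unset Printing Implicit Defensive.

Import Order.TTheory GRing.Theory Num.Theory.
Local Open Scope ring_scope.

(** Write e(y) for exp(2 pi i y).  The number of ones is a sum over digits, so
    the weighted exponential sum over all n-digit strings factors:
      sum_x z^wt(x) e(-x t / N) = prod_(j < n) (1 + z e(-2^j t / N)).
    For z = e(k / m) with m = n + 1 its modulus is 2^n A_k(t), where
    A_k(t) = prod_j |cos pi (k / m - 2^j t / N)|, and averaging z^-w times this
    sum over the m-th roots of unity isolates the weight w.  Hence
    |S^_w(t)| <= (2^n / N) times the mean over k of A_k(t)
    ([cmod_char_sum]; S^_w is the Fourier transform of the weight class).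

    Two estimates for A_k carry the proof; s_k denotes sin (pi k / m).

    - Mean square ([sum_amp_sqr]): by Parseval sum_t A_k(t)^2 <= 2 for each k.
    - Pointwise ([orbit_bound], [amp_sqr_le]): for t <> 0,
      A_k(t)^2 <= (K / n) (1 + n s_k^2)^-4.

    For the pointwise bound put theta = pi k / m, a = pi t / N, and look at the
    orbit of a under doubling, which is n-periodic modulo pi.  Let
    S = sum_j sin^2 (theta - 2^j a), so that A_k^2 <= exp(-S), and let beta > 0
    be the least of the b_j = |sin 2^j a|.
    (i) Twice (theta - 2^j a) minus (theta - 2^(j+1) a) is theta, so
        consecutive terms of S cannot both be much smaller than s_k^2; hence
        n s_k^2 <= 10 S.
    (ii) Doubling expands near 0: 1 / b_j - 1 / b_(j+1) is at least 4/5 unless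
        b_j is large.  These differences cancel around the cycle, so b_j is
        large often: n beta <= 5 sum_j b_j^2, and with (i) n beta <= 110 S.
    (iii) The predecessor of the minimal point lies near pi / 2 modulo pi,
        because it is not itself closer to 0; so the product has one factor
        cos^2 that is at most beta^2 + 2 s_k^2.
    Together A_k^2 is at most a constant times (beta^2 + s_k^2) exp(-S), where
    exp(-S) absorbs beta^2 into n^-2 by (ii) and decays in n s_k^2 by (i).

    The two estimates give sum_(t <> 0) A_k(t)^4 <= (2 K / n) v_k^4 with
    v_k = (1 + n s_k^2)^-1, and Hoelder's inequality with the weights v_k
    ([weighted_pow4_sum]) yields
      sum_(t <> 0) (sum_k A_k(t))^4 <= (2 K / n) (sum_k v_k)^4.
    As s_k is at least of the order of the distance from k / m to the nearest
    integer, sum_k v_k = O(sqrt n) ([sum_hump]).  The right-hand side is O(n),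
    and division by m^4 leaves O(n^-3).

    The energy statement is the same one: N times the energy is the fourth
    moment of the exponential sums of S_w ([fourth_moment]), and its t = 0 term
    is |S_w|^4 = 'C(n, w)^4. *)

(** * Trigonometric lower bound and cyclic sums *)

Lemma sum_cyclic_shift (V : zmodType) (n : nat) (f : nat -> V) :
  f n = f 0%N -> \sum_(j < n) f j.+1 = \sum_(j < n) f j.
Proof.
move=> fn; apply/eqP; rewrite -subr_eq0 -sumrB.
by rewrite -(big_mkord xpredT (fun j => f j.+1 - f j)) telescope_sumr // fn subrr.
Qed.

Section Trigo.
Variable R : realType.
Implicit Types x y : R.

Lemma norm_sin_addpin x (k : nat) : `|sin (x + pi *+ k)| = `|sin x|.
Proof.
elim: k => [|k IH]; first by rewrite mulr0n addr0.
by rewrite mulrSr addrA sinDpi normrN.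
Qed.

Lemma norm_sinM_natl x (k : nat) : `|sin (k%:R * x)| <= k%:R * `|sin x|.
Proof.
elim: k => [|k IH]; first by rewrite !mul0r sin0 normr0.
rewrite -natr1 !mulrDl !mul1r sinD (le_trans (ler_normD _ _)) //.
have c1 := cos_max x; have c2 := cos_max (k%:R * x).
rewrite !normrM; apply: lerD.
  by apply: le_trans IH; rewrite ler_piMr.
by rewrite ler_piMl.
Qed.

(** A multiple j x of x = pi k / m with j as large as possible lies in
    [pi/4, pi/2], where sin^2 is at least 1/2; then |sin (j x)| <= j |sin x|
    gives the bound. *)
Lemma sin_sqr_lower (k m : nat) : (0 < k)%N -> (k.*2 <= m)%N ->
  2 * (k%:R / m%:R) ^+ 2 <= sin (pi * (k%:R / m%:R)) ^+ 2 :> R.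
Proof.
move=> k0 km; have m0 : (0 < m)%N by lia.
set x := pi * _; set j := (m %/ k.*2)%N.
have j0 : (0 < j)%N by rewrite divn_gt0; lia.
have jle : (j * k.*2 <= m)%N by exact: leq_divM.
have jgt : (m <= j.*2 * k.*2)%N.
  by have := ltn_ceil m (_ : 0 < k.*2)%N; rewrite -/j; nia.
have mR : 0 < m%:R :> R by rewrite ltr0n.
have jR : 0 < j%:R :> R by rewrite ltr0n.
have kR : 0 < k%:R :> R by rewrite ltr0n.
have jleR : j%:R * (2 * k%:R) <= m%:R :> R.
  by rewrite -natrM -natrM ler_nat mul2n.
have jgtR : m%:R <= (2 * j%:R) * (2 * k%:R) :> R.
  by rewrite -!natrM ler_nat !mul2n.
have xE : x * m%:R = pi * k%:R by rewrite /x; field; rewrite gt_eqF.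
have p0 : 0 < pi :> R := pi_gt0 R.
have u1 : (j%:R * x) *+ 2 <= pi.
  rewrite -(ler_pM2r mR); have -> : j%:R * x *+ 2 * m%:R = pi * (j%:R * (2 * k%:R)).
    by rewrite -mulr_natr; ring: xE.
  by rewrite ler_pM2l.
have u2 : pi / 2 <= (j%:R * x) *+ 2.
  rewrite -(ler_pM2r mR); have -> : j%:R * x *+ 2 * m%:R = pi / 2 * (2 * j%:R * (2 * k%:R)).
    by rewrite -mulr_natr; field: xE.
  by rewrite ler_pM2l // divr_gt0.
have s2 : 1 / 2 <= sin (j%:R * x) ^+ 2.
  have : 0 <= sin ((j%:R * x) *+ 2 - pi / 2).
    by apply: sin_ge0_pi; apply/andP; split; lra.
  rewrite sinBpihalf cos_mulr2n => h.
  have := cos2Dsin2 (j%:R * x); lra.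
have := norm_sinM_natl x j; rewrite -(ler_pXn2r (_ : 0 < 2)%N) ?nnegrE ?mulr_ge0 ?ler0n //.
rewrite exprMn !real_normK ?num_real // => h.
have {}h := le_trans s2 h.
rewrite -(ler_pM2l (_ : 0 < (2 * k%:R * j%:R)^+2)); last by rewrite exprn_gt0 // !mulr_gt0.
apply: (@le_trans _ _ (2 * k%:R ^+ 2)).
  have -> : (2 * k%:R * j%:R) ^+ 2 * (2 * (k%:R / m%:R) ^+ 2) =
      (2 * k%:R ^+ 2) * ((j%:R * (2 * k%:R)) / m%:R) ^+ 2 :> R.
    by field; rewrite gt_eqF.
  rewrite ler_piMr ?mulr_ge0 ?sqr_ge0 // expr_le1 ?divr_ge0 ?mulr_ge0 ?ler0n //.
  by rewrite ler_pdivrMr // mul1r.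
have -> : (2 * k%:R * j%:R) ^+ 2 * sin x ^+ 2 = (2 * k%:R) ^+ 2 * (j%:R ^+ 2 * sin x ^+ 2) :> R by ring.
have -> : 2 * k%:R ^+ 2 = (2 * k%:R) ^+ 2 * (1 / 2) :> R by field.
by rewrite ler_pM2l // exprn_gt0 // mulr_gt0.
Qed.

End Trigo.

(** * Products of cosines along a periodic orbit of doubling *)

Section OrbitBound.
Variables (R : realType) (n t : nat) (a th : R).
Hypothesis n_gt0 : (0 < n)%N.
Hypothesis a_periodic : 2 ^+ n * a = a + pi *+ t.
Hypothesis sin_a_neq0 : sin a != 0.

(* b measures the orbit of a itself, s the orbit seen from th: the factors of
   the product to be bounded are 1 - s j ^+ 2. *)
Let b (j : nat) : R := `|sin (2 ^+ j * a)|.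
Let c (j : nat) : R := `|cos (2 ^+ j * a)|.
Let s (j : nat) : R := `|sin (th - 2 ^+ j * a)|.
Let sigma : R := `|sin th|.
Let S : R := \sum_(j < n) s j ^+ 2.

Let b_ge0 j : 0 <= b j. Proof. exact: normr_ge0. Qed.
Let b_le1 j : b j <= 1. Proof. exact: sin_max. Qed.
Let s_ge0 j : 0 <= s j. Proof. exact: normr_ge0. Qed.
Let c_ge0 j : 0 <= c j. Proof. exact: normr_ge0. Qed.
Let sigma_ge0 : 0 <= sigma. Proof. exact: normr_ge0. Qed.
Let bc1 j : c j ^+ 2 + b j ^+ 2 = 1.
Proof. by rewrite /b /c !real_normK ?num_real // cos2Dsin2. Qed.

Let b_double j : b j.+1 = 2 * b j * c j.
Proof.
rewrite /b /c exprS -mulrA mulr_natl sin_mulr2n -mulr_natl !normrM.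
by rewrite ger0_norm //; ring.
Qed.

Let b_cycle : b n = b 0%N.
Proof. by rewrite /b a_periodic norm_sin_addpin expr0 mul1r. Qed.

Let s_cycle : s n = s 0%N.
Proof.
rewrite /s -normrN -sinN opprB a_periodic addrAC norm_sin_addpin.
by rewrite -normrN -sinN opprB expr0 mul1r.
Qed.

Let b_gt0 j : (j <= n)%N -> 0 < b j.
Proof.
move=> jn; rewrite lt_def b_ge0 andbT; apply/eqP => bj0.
suff bn0 : b n = 0.
  by move: sin_a_neq0; rewrite -normr_eq0 -[a]mul1r -(expr0 2) -/(b 0) -b_cycle bn0 eqxx.
rewrite -(subnK jn); elim: (n - j)%N => [|k IH] //.
by rewrite addSn b_double IH mulr0 mul0r.
Qed.

(** Twice (th - 2^j a) minus (th - 2^(j+1) a) is th: two consecutive points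
    cannot both be close to th unless th is close to a multiple of pi. *)
Let sigma_le j : sigma <= 2 * s j + s j.+1.
Proof.
rewrite /sigma /s; set u := th - 2 ^+ j * a; set v := th - _.
have -> : th = u *+ 2 - v by rewrite /u /v exprS; ring.
have cu := cos_max u; have cv := cos_max v; have cu2 := cos_max (u *+ 2).
rewrite sinB sin_mulr2n (le_trans (ler_normB _ _)) //.
rewrite !normrM normrMn normrM -mulr_natl.
have h1 : `|cos u| * `|sin u| * `|cos v| <= `|sin u|.
  by rewrite -mulrA mulrCA ler_piMr ?normr_ge0 // mulr_ile1.
have h2 : `|cos (u *+ 2)| * `|sin v| <= `|sin v| by rewrite ler_piMl.
by rewrite -mulrA; lra.
Qed.

(** [sigma_le] squared, (2 x + y)^2 <= 5 (x^2 + y^2), and summed around the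
    cycle, where each s_j is counted twice. *)
Let S_ge_sigma : n%:R * sigma ^+ 2 <= 10 * S.
Proof.
have sh : \sum_(j < n) s j.+1 ^+ 2 = S.
  by apply: (sum_cyclic_shift (f := fun j => s j ^+ 2)); rewrite s_cycle.
have -> : 10 * S = \sum_(j < n) 5 * (s j ^+ 2 + s j.+1 ^+ 2).
  by rewrite -mulr_sumr big_split /= sh /S; ring.
have -> : n%:R * sigma ^+ 2 = \sum_(j < n) sigma ^+ 2.
  by rewrite sumr_const card_ord mulr_natl.
apply: ler_sum => j _.
have h := sigma_le j; have s0 := s_ge0 j; have s1 := s_ge0 j.+1.
have : sigma ^+ 2 <= (2 * s j + s j.+1) ^+ 2.
  by rewrite ler_sqr ?nnegrE // addr_ge0 ?mulr_ge0.
have := sqr_ge0 (s j - 2 * s j.+1); nra.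
Qed.

Let b_le j : b j <= s j + sigma.
Proof.
rewrite /b /s /sigma; set v := _ * a.
have -> : v = th - (th - v) by ring.
have -> : th - (th - (th - v)) = th - v by ring.
rewrite sinB (le_trans (ler_normB _ _)) // !normrM addrC.
by apply: lerD; [rewrite ler_piMl // cos_max | rewrite ler_piMr // cos_max].
Qed.

(** As b_j <= s_j + sigma, the orbit can stay away from 0 without making S
    large only by staying near th; the cost n sigma^2 of this is itself at most
    10 S. *)
Let S_ge_b : \sum_(j < n) b j ^+ 2 <= 22 * S.
Proof.
apply: (@le_trans _ _ (\sum_(j < n) (2 * s j ^+ 2 + 2 * sigma ^+ 2))).
  apply: ler_sum => j _; have h := b_le j.
  have : b j ^+ 2 <= (s j + sigma) ^+ 2.
    by rewrite ler_sqr ?nnegrE ?addr_ge0.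
  have := sqr_ge0 (s j - sigma); nra.
rewrite big_split /= -mulr_sumr -/S sumr_const card_ord -mulr_natl.
have := S_ge_sigma; nra.
Qed.

(* The minimum is indexed by a successor so that its predecessor j0, the point
   where the product has a small factor, is at hand. *)
Variable j0 : nat.
Hypothesis j0n : (j0 < n)%N.
Hypothesis j0_min : forall j, (j < n)%N -> b j0.+1 <= b j.+1.
Let beta := b j0.+1.

Let beta_gt0 : 0 < beta. Proof. exact: b_gt0. Qed.
Let beta_min j : (j <= n)%N -> beta <= b j.
Proof.
case: j => [_|j jn]; last exact: j0_min.
by rewrite -b_cycle -(prednK n_gt0); apply: j0_min; rewrite prednK.
Qed.

(** Expansion near 0: if b_j <= 1/2 then b_(j+1) >= (5/3) b_j, which makes
    the difference of inverses at least 4/5.  If b_j > 1/2 the difference may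
    be as low as 1 - 1/beta, and the term 4 b_j^2 / beta > 1 / beta pays for
    that. *)
Let b_step j : (j < n)%N ->
  4 / 5 - 4 / beta * b j ^+ 2 <= (b j)^-1 - (b j.+1)^-1.
Proof.
move=> jn; have bj := b_gt0 (ltnW jn); have bj1 := b_gt0 jn.
have b1 := b_le1 j; have bc := bc1 j; have bd := b_double j; have cj := c_ge0 j.
have [small|big] := lerP (b j) (1 / 2).
  have h1 : (5 / 3) * b j <= b j.+1.
    have c56 : 5 / 6 <= c j.
      rewrite -ler_sqr ?nnegrE ?divr_ge0 //.
      have : b j ^+ 2 <= (1 / 2) ^+ 2 by rewrite ler_sqr ?nnegrE ?divr_ge0.
      lra.
    by rewrite bd; nra.
  have h2 : (b j.+1)^-1 <= (3 / 5) * (b j)^-1.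
    have -> : 3 / 5 * (b j)^-1 = (5 / 3 * b j)^-1 by field; rewrite gt_eqF.
    by rewrite lef_pV2 ?posrE // mulr_gt0 // divr_gt0.
  have h3 : 2 <= (b j)^-1.
    have -> : 2 = (1 / 2)^-1 :> R by rewrite invf_div divr1.
    by rewrite lef_pV2 ?posrE ?divr_gt0.
  have : 0 <= 4 / beta * b j ^+ 2 by rewrite mulr_ge0 ?sqr_ge0 // divr_ge0 // ltW.
  lra.
have h1 : 1 <= (b j)^-1 by rewrite invf_ge1.
have h2 : (b j.+1)^-1 <= beta^-1 by rewrite lef_pV2 ?posrE // beta_min.
have h3 : beta^-1 <= 4 / beta * b j ^+ 2.
  have -> : 4 / beta * b j ^+ 2 = (4 * b j ^+ 2) * beta^-1 by ring.
  rewrite ler_peMl ?invr_ge0 ?(ltW beta_gt0) //; nra.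
lra.
Qed.

(** The differences in [b_step] telescope to zero around the cycle. *)
Let sum_b_ge : n%:R * beta <= 5 * \sum_(j < n) b j ^+ 2.
Proof.
have : \sum_(j < n) (4 / 5 - 4 / beta * b j ^+ 2) <=
       \sum_(j < n) ((b j)^-1 - (b j.+1)^-1).
  by apply: ler_sum => j _; apply: b_step.
rewrite !sumrB (sum_cyclic_shift (f := fun j => (b j)^-1)) ?b_cycle // subrr.
rewrite sumr_const card_ord -mulr_sumr; set B := \sum_(_ < _) _ => h.
rewrite -(ler_pM2l (_ : 0 < 4 / 5 / beta)) ?divr_gt0 //.
have -> : 4 / 5 / beta * (n%:R * beta) = 4 / 5 * n%:R by field; rewrite gt_eqF.
have -> : 4 / 5 / beta * (5 * B) = 4 / beta * B by field; rewrite gt_eqF.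
by rewrite -mulr_natr in h; lra.
Qed.

(** The minimum beta is 2 b_j0 c_j0 with b_j0 >= beta, so c_j0 <= 1/2: the
    point before the minimum is far from 0, hence b_j0 is bounded below and
    c_j0 is of the order of beta. *)
Let factor_le : cos (th - 2 ^+ j0 * a) ^+ 2 <= beta ^+ 2 + 2 * sigma ^+ 2.
Proof.
have bj := b_gt0 (ltnW j0n); have bd : beta = 2 * b j0 * c j0 := b_double j0.
have bm := beta_min (ltnW j0n); have cj := c_ge0 j0; have bc := bc1 j0.
have c12 : c j0 <= 1 / 2.
  rewrite -(ler_pM2l (_ : 0 < 2 * b j0)) ?mulr_gt0 // -bd.
  by have -> : 2 * b j0 * (1 / 2) = b j0 by field.
have c2 : c j0 ^+ 2 <= 1 / 4 by nra.
have c2' : c j0 ^+ 2 * 2 <= beta ^+ 2.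
  have -> : beta ^+ 2 = 4 * b j0 ^+ 2 * c j0 ^+ 2 by rewrite bd; ring.
  by have := sqr_ge0 (c j0); nra.
have : `|cos (th - 2 ^+ j0 * a)| <= c j0 + sigma.
  rewrite cosB (le_trans (ler_normD _ _)) // !normrM.
  by apply: lerD; [rewrite ler_piMl // cos_max | rewrite ler_piMr // sin_max].
rewrite -ler_sqr ?nnegrE ?addr_ge0 // real_normK ?num_real //.
have := sqr_ge0 (c j0 - sigma); nra.
Qed.

(** All factors but the one at j0 are bounded by exp (- s_j^2); the missing
    term s_j0^2 <= 1 of S costs the constant expR 1. *)
Let prod_le_expS :
  \prod_(j < n) cos (th - 2 ^+ j * a) ^+ 2 <=
  (beta ^+ 2 + 2 * sigma ^+ 2) * (expR 1 * expR (- S)).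
Proof.
rewrite (bigD1 (Ordinal j0n)) //=; apply: ler_pM; rewrite ?sqr_ge0 //.
  by apply: prodr_ge0 => j _; rewrite sqr_ge0.
apply: (@le_trans _ _ (\prod_(j < n | j != Ordinal j0n) expR (- s j ^+ 2))).
  apply: ler_prod => j _; rewrite sqr_ge0 /= cos2sin2 /s real_normK ?num_real //.
  exact: expR_ge1Dx.
rewrite -expR_sum -expRD ler_expR /S [X in - X](bigD1 (Ordinal j0n)) //= sumrN opprD addrA.
rewrite lerDr subr_ge0 expr_le1 //; exact: sin_max.
Qed.

Lemma orbit_bound_argmin :
  \prod_(j < n) cos (th - 2 ^+ j * a) ^+ 2 <=
  expR 1 * ((440 / n%:R) ^+ 2 + 2 * sin th ^+ 2)
    * expR (- (n%:R * sin th ^+ 2 / 20)).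
Proof.
have sE : sin th ^+ 2 = sigma ^+ 2 by rewrite /sigma real_normK ?num_real.
rewrite sE; apply: (le_trans prod_le_expS).
have nR : 0 < n%:R :> R by rewrite ltr0n.
have S1 := S_ge_sigma; have S2 : n%:R * beta <= 110 * S.
  by apply: (le_trans sum_b_ge); have := S_ge_b; lra.
(* S is at least the mean of its lower bounds n beta / 110 = 4 y and
   n sigma^2 / 10; the first half gives exp (- 2 y), which beats beta^2. *)
set y := n%:R * beta / 440; have y0 : 0 <= y by rewrite divr_ge0 ?mulr_ge0 // ltW.
have eS : expR (- S) <= (expR y ^+ 2)^-1 * expR (- (n%:R * sigma ^+ 2 / 20)).
  rewrite -expRM_natl -expRN -expRD ler_expR /y; lra.
have ey : y ^+ 2 <= expR y ^+ 2.
  rewrite ler_sqr ?nnegrE ?expR_ge0 //; have := expR_ge1Dx y; lra.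
have e1 : 1 <= expR y ^+ 2.
  by rewrite expr_ge1 ?expR_ge0 //; have := expR_ge1Dx y; lra.
have ep : 0 < expR y ^+ 2 by rewrite exprn_gt0 ?expR_gt0.
apply: (@le_trans _ _ ((beta ^+ 2 + 2 * sigma ^+ 2) *
    (expR 1 * ((expR y ^+ 2)^-1 * expR (- (n%:R * sigma ^+ 2 / 20)))))).
  apply: ler_wpM2l; first by rewrite addr_ge0 ?sqr_ge0 // mulr_ge0 ?sqr_ge0.
  by apply: ler_wpM2l; [exact: expR_ge0|exact: eS].
rewrite [leLHS](_ : _ = expR 1 * ((beta ^+ 2 + 2 * sigma ^+ 2) / expR y ^+ 2)
   * expR (- (n%:R * sigma ^+ 2 / 20))); last by ring.
apply: ler_wpM2r; first exact: expR_ge0.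
apply: ler_wpM2l; first exact: expR_ge0.
rewrite ler_pdivrMr // [leRHS]mulrDl.
apply: lerD; last by rewrite ler_peMr // mulr_ge0 ?sqr_ge0.
have -> : beta ^+ 2 = (440 / n%:R) ^+ 2 * y ^+ 2 by rewrite /y; field; rewrite gt_eqF.
by rewrite ler_wpM2l ?sqr_ge0.
Qed.

End OrbitBound.

(** The term in sin^2 th is the value of the factor at a point near pi / 2, and
    440 / n the largest displacement beta of that point which the decay
    exp (- n beta / 220) leaves visible.  The exponential in n sin^2 th comes
    from the fact that, of any two consecutive points of the orbit, one has
    s_j at least of the order of |sin th|. *)
Lemma orbit_bound (R : realType) (n t : nat) (a th : R) : (0 < n)%N ->
  2 ^+ n * a = a + pi *+ t -> sin a != 0 ->
  \prod_(j < n) cos (th - 2 ^+ j * a) ^+ 2 <=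
  expR 1 * ((440 / n%:R) ^+ 2 + 2 * sin th ^+ 2)
    * expR (- (n%:R * sin th ^+ 2 / 20)).
Proof.
move=> n0 pa sa.
pose b (j : 'I_n) := `|sin (2 ^+ j.+1 * a)|.
have [j0 _ jmin] := Order.TotalTheory.arg_minP b (isT : xpredT (Ordinal n0)).
apply: (orbit_bound_argmin th n0 pa sa (ltn_ord j0)) => j jn.
exact: jmin (Ordinal jn) isT.
Qed.

(** The exponential decay in n sin^2 th is traded for a fourth power, the form
    in which it is balanced against the weights [hump]. *)
Lemma orbit_bound_pow4 (R : realType) (n t : nat) (a th : R) : (0 < n)%N ->
  2 ^+ n * a = a + pi *+ t -> sin a != 0 ->
  \prod_(j < n) cos (th - 2 ^+ j * a) ^+ 2 <=
  (expR 2 * 440 ^+ 2 * 100 ^+ 5) / n%:R * (1 + n%:R * sin th ^+ 2) ^- 4.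
Proof.
move=> n0 pa sa; apply: (le_trans (orbit_bound th n0 pa sa)).
have nR : 1 <= n%:R :> R by rewrite ler1n.
have n0R : 0 < n%:R :> R by lra.
set X := n%:R * sin th ^+ 2.
have X0 : 0 <= X by rewrite mulr_ge0 ?sqr_ge0 // ltW.
have -> : sin th ^+ 2 = X / n%:R by rewrite /X; field; rewrite gt_eqF.
have h1 : (440 / n%:R) ^+ 2 + 2 * (X / n%:R) <= 440 ^+ 2 * (1 + X) / n%:R :> R.
  rewrite -(ler_pM2r (_ : 0 < n%:R ^+ 2 :> R)) ?exprn_gt0 //.
  have -> : ((440 / n%:R) ^+ 2 + 2 * (X / n%:R)) * n%:R ^+ 2 = 440 ^+ 2 + 2 * X * n%:R.
    by field; rewrite gt_eqF.
  have -> : 440 ^+ 2 * (1 + X) / n%:R * n%:R ^+ 2 = 440 ^+ 2 * (1 + X) * n%:R.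
    by field; rewrite gt_eqF.
  have : 0 <= X * n%:R by rewrite mulr_ge0 // ltW.
  have : 2 <= 440 ^+ 2 :> R by rewrite expr2; lra.
  by set q := 440 ^+ 2; nra.
have h2 : expR (- (X / 20)) <= expR 1 * 100 ^+ 5 / (1 + X) ^+ 5.
  rewrite ler_pdivlMr ?exprn_gt0 //; last lra.
  rewrite expRN mulrC ler_pdivrMr ?expR_gt0 //.
  have -> : expR 1 * 100 ^+ 5 * expR (X / 20) = 100 ^+ 5 * (expR 1 * expR (X / 20)) by ring.
  (* (1 + X) / 100 <= exp ((1 + X) / 100), whose fifth power is
     exp ((1 + X) / 20). *)
  apply: (@le_trans _ _ (100 ^+ 5 * (expR ((1 + X) / 100)) ^+ 5)).
    rewrite -exprMn lerXn2r ?nnegrE ?mulr_ge0 ?expR_ge0 //; first lra.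
    by have := expR_ge1Dx ((1 + X) / 100); lra.
  apply: ler_wpM2l; first by rewrite exprn_ge0.
  rewrite -expRM_natl -expRD ler_expR; lra.
apply: (@le_trans _ _ (expR 1 * (440 ^+ 2 * (1 + X) / n%:R) * (expR 1 * 100 ^+ 5 / (1 + X) ^+ 5))).
  apply: ler_pM; rewrite ?expR_ge0 ?mulr_ge0 ?expR_ge0 //.
    by rewrite addr_ge0 ?sqr_ge0 // mulr_ge0 // divr_ge0 // ltW.
  by rewrite ler_wpM2l ?expR_ge0.
have -> : expR 2 = expR 1 * expR 1 :> R by rewrite -expRD; congr expR; lra.
rewrite le_eqVlt; apply/orP; left; apply/eqP.
by field; apply/andP; split; rewrite gt_eqF //; lra.
Qed.

(** * Binary weights *)

Lemma wt_le (n x : nat) : (wt n x <= n)%N.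
Proof.
rewrite /wt -[X in (_ <= X)%N]card_ord -sum1_card; apply: leq_sum => i _.
by rewrite -ltnS ltn_mod.
Qed.

Lemma wtS_low (n x : nat) : (x < 2 ^ n)%N -> wt n.+1 x = wt n x.
Proof. by move=> xn; rewrite /wt big_ord_recr /= divn_small // addn0. Qed.

Lemma wtS_high (n x : nat) : (x < 2 ^ n)%N -> wt n.+1 (2 ^ n + x) = (wt n x).+1.
Proof.
move=> xn; rewrite /wt big_ord_recr /= divnDl // divnn expn_gt0 /= divn_small //.
rewrite addn0 addn1; congr _.+1; apply: eq_bigr => i _.
rewrite divnDl ?dvdn_exp2l // 1?ltnW // -expnB ?(ltnW (ltn_ord i)) // -modnDml.
by rewrite -(subnK (_ : 0 < n - i)%N) ?subn_gt0 // addn1 expnS modnMr.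
Qed.

Lemma wt_mersenne (n : nat) : wt n (mersenne n) = n.
Proof.
elim: n => [|n IH]; first by rewrite /wt big_ord0.
rewrite /mersenne expnS mul2n -addnn -addnBA ?expn_gt0 // wtS_high.
  by rewrite -/(mersenne n) IH.
by rewrite subn1 prednK ?expn_gt0.
Qed.

(** Both digits being possible at each position, the generating function of
    the pairs (weight, value) is a product over the positions. *)
Lemma sum_wt_pow (C : comNzRingType) (z u : C) (n : nat) :
  \sum_(x < 2 ^ n) z ^+ wt n x * u ^+ x = \prod_(j < n) (1 + z * u ^+ (2 ^ j)).
Proof.
elim: n => [|n IH].
  by rewrite big_ord0 expn0 big_ord1 /wt big_ord0 !expr0 mulr1.
rewrite big_ord_recr /= -IH expnS mul2n -addnn big_split_ord /= mulrDr mulr1.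
congr (_ + _); first by apply: eq_bigr => i _; rewrite wtS_low.
rewrite big_distrl /=; apply: eq_bigr => i _.
by rewrite wtS_high // exprS exprD; ring.
Qed.

(** The coefficient of 'X^w in [sum_wt_pow] at z = 'X and u = 1. *)
Lemma card_wt (n w : nat) : (\sum_(x < 2 ^ n) (wt n x == w))%N = 'C(n, w).
Proof.
have := sum_wt_pow 'X (1 : {poly int}) n.
under eq_bigr do rewrite expr1n mulr1.
under [RHS]eq_bigr do rewrite expr1n mulr1 addrC.
rewrite prodr_const card_ord => /(congr1 (fun p : {poly int} => p`_w)).
rewrite coef_sum addrC exprDn coef_sum.
under eq_bigr do rewrite coefXn eq_sym.
under [in RHS]eq_bigr do rewrite expr1n mul1r coefMn coefXn.
move=> h; apply/eqP; rewrite -eqz_nat -natz natr_sum; apply/eqP.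
rewrite h; have [wn|nw] := leqP w n; last first.
  rewrite bin_small // big1 // => i _; case: eqP => [wi|]; last by rewrite mul0rn.
  by have := ltn_ord i; lia.
rewrite (bigD1 (Ordinal (wn : w < n.+1)%N)) //= eqxx big1 ?addr0 ?natz // => i iw.
by case: eqP => [wi|]; rewrite ?mul0rn //; move: iw; rewrite -val_eqE /= wi eqxx.
Qed.

(** * Characters of the cyclic group, Parseval and additive energy *)

Lemma sum_quadruple (T : finType) (F : T * T * T * T -> nat) :
  (\sum_q F q = \sum_a \sum_b \sum_c \sum_d F (a, b, c, d))%N.
Proof. by rewrite !pair_bigA; apply: eq_bigr => -[[[a b] c] d]. Qed.

Section CyclicFourier.
Variables (C : numClosedFieldType) (N : nat) (u : C).
Hypotheses (N_gt1 : (1 < N)%N) (u_prim : N.-primitive_root u).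

Lemma norm_prim_root : `|u| = 1.
Proof.
apply/eqP; rewrite -(@pexpr_eq1 _ _ N) ?normr_ge0 //; last exact: ltnW.
by rewrite -normrX (prim_expr_order u_prim) normr1.
Qed.

Lemma sum_prim_root_pow (k : nat) :
  \sum_(t < N) u ^+ (k * t) = if (N %| k)%N then N%:R else 0.
Proof.
under eq_bigr do rewrite exprM.
rewrite (prim_order_dvd u_prim); case: eqP => [->|/eqP uk].
  under eq_bigr do rewrite expr1n.
  by rewrite sumr_const card_ord.
apply: (mulfI (_ : u ^+ k - 1 != 0)); first by rewrite subr_eq0.
by rewrite -subrX1 mulr0 -exprM mulnC exprM (prim_expr_order u_prim) expr1n subrr.
Qed.

Implicit Types (x t : 'Z_N).

Lemma sum_char x : \sum_(t : 'Z_N) u ^+ (x * t) = (x == 0)%:R * N%:R.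
Proof.
have reindex (k : nat) : \sum_(t : 'Z_N) u ^+ (k * t) = \sum_(t < N) u ^+ (k * t).
  by rewrite -!(big_mkord xpredT (fun i => u ^+ (k * i))) (Zp_cast N_gt1).
rewrite reindex sum_prim_root_pow.
have xN : (x < N)%N by rewrite -{2}(Zp_cast N_gt1).
rewrite -val_eqE /=; case: (posnP x) => [->|x0]; first by rewrite dvdn0 mul1r.
by rewrite gtnNdvd // mul0r.
Qed.

Lemma charD x y t : u ^+ ((x + y)%R * t) = u ^+ (x * t) * u ^+ (y * t).
Proof.
have -> : (x + y)%R = ((x + y) %% N)%N :> nat.
  by congr (_ %% _)%N; exact: Zp_cast.
by rewrite exprM (prim_expr_mod u_prim) -exprM mulnDl exprD.
Qed.

Lemma charB x y t : u ^+ ((x - y)%R * t) = u ^+ (x * t) * (u ^+ (y * t))^*.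
Proof.
have un : `|u ^+ (y * t)| = 1 by rewrite normrX norm_prim_root expr1n.
have := charD (x - y) y t; rewrite subrK => ->.
by rewrite -mulrA -normCK un expr1n mulr1.
Qed.

Lemma parseval (f : 'Z_N -> C) :
  \sum_(t : 'Z_N) `|\sum_x f x * u ^+ (x * t)| ^+ 2 = N%:R * \sum_x `|f x| ^+ 2.
Proof.
under eq_bigr => t _ do rewrite normCK rmorph_sum mulr_suml.
rewrite exchange_big mulr_sumr; apply: eq_bigr => x _ /=.
under eq_bigr => t _ do rewrite mulr_sumr.
rewrite exchange_big /= (bigD1 x) //= [X in _ + X]big1 => [|y yx].
  under eq_bigr => t _ do rewrite rmorphM mulrACA -charB.
  by rewrite -mulr_sumr sum_char subrr eqxx mul1r addr0 normCK mulrC.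
under eq_bigr => t _ do rewrite rmorphM mulrACA -charB.
by rewrite -mulr_sumr sum_char subr_eq0 eq_sym (negPf yx) mul0r mulr0.
Qed.

Definition pair_count (A : {set 'Z_N}) (s : 'Z_N) : nat :=
  (\sum_(a in A) \sum_(b in A) (a + b == s)%R)%N.

Lemma energy_pair_count (A : {set 'Z_N}) :
  energy A = (\sum_s pair_count A s ^ 2)%N.
Proof.
rewrite /energy -sum1_card big_mkcond /= sum_quadruple.
under eq_bigr do under eq_bigr do under eq_bigr do under eq_bigr do rewrite inE.
have sq s : (pair_count A s ^ 2 = \sum_(a in A) \sum_(b in A) \sum_(c in A)
    \sum_(d in A) (a + b == s)%R * (c + d == s)%R)%N.
  rewrite -mulnn {1}/pair_count big_distrl; apply: eq_bigr => a _ /=.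
  rewrite big_distrl; apply: eq_bigr => b _ /=; rewrite big_distrr.
  by apply: eq_bigr => c _ /=; rewrite big_distrr.
under [RHS]eq_bigr do rewrite sq.
rewrite [RHS]exchange_big [RHS]big_mkcond; apply: eq_bigr => a _ /=.
case: (a \in A); last by rewrite big1 // => b _; rewrite big1 // => c _; rewrite big1.
rewrite [RHS]exchange_big [RHS]big_mkcond; apply: eq_bigr => b _ /=.
case: (b \in A); last by rewrite big1 // => c _; rewrite big1.
rewrite [RHS]exchange_big [RHS]big_mkcond; apply: eq_bigr => c _ /=.
case: (c \in A); last by rewrite big1.
rewrite [RHS]exchange_big [RHS]big_mkcond; apply: eq_bigr => d _ /=.
case: (d \in A) => //=.
rewrite (bigD1 (a + b)) //= eqxx mul1n big1 ?addn0 => [|s].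
  by rewrite eq_sym; case: eqP.
by rewrite eq_sym => /negPf ->.
Qed.

(** The square of the exponential sum of A has the numbers of representations
    [pair_count A] as coefficients; Parseval applies to it. *)
Lemma fourth_moment (A : {set 'Z_N}) :
  \sum_(t : 'Z_N) `|\sum_(x in A) u ^+ (x * t)| ^+ 4 = N%:R * (energy A)%:R.
Proof.
rewrite energy_pair_count natr_sum.
under [in RHS]eq_bigr => s _ do rewrite natrX -[_%:R]ger0_norm ?ler0n //.
rewrite -parseval; apply: eq_bigr => t _.
rewrite -[4%N]/(2 * 2)%N exprM -normrX; congr (`|_| ^+ 2).
under [RHS]eq_bigr => s _ do rewrite natr_sum mulr_suml.
rewrite exchange_big expr2 mulr_suml; apply: eq_bigr => a _ /=.
under [RHS]eq_bigr => s _ do rewrite natr_sum mulr_suml.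
rewrite exchange_big mulr_sumr; apply: eq_bigr => b _ /=.
rewrite (bigD1 (a + b)) //= eqxx mul1r charD big1 ?addr0 // => s.
by rewrite eq_sym => /negPf ->; rewrite mul0r.
Qed.

End CyclicFourier.

(** * Weighted power means and the weights used *)

Section Averages.
Variable R : realType.

Lemma jensen_sqr (I : finType) (v y : I -> R) : (forall i, 0 <= v i) ->
  (\sum_i v i * y i) ^+ 2 <= (\sum_i v i) * \sum_i v i * y i ^+ 2.
Proof.
move=> v0; rewrite -subr_ge0.
suff -> : (\sum_i v i) * (\sum_i v i * y i ^+ 2) - (\sum_i v i * y i) ^+ 2 =
    2^-1 * \sum_i \sum_j v i * v j * (y i - y j) ^+ 2.
  rewrite mulr_ge0 ?invr_ge0 // sumr_ge0 // => i _; rewrite sumr_ge0 // => j _.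
  by rewrite mulr_ge0 ?sqr_ge0 ?mulr_ge0.
have -> : \sum_i \sum_j v i * v j * (y i - y j) ^+ 2 =
    \sum_i \sum_j (v i * (v j * y j ^+ 2) + (v i * y i ^+ 2) * v j
      - 2 * ((v i * y i) * (v j * y j))).
  by apply: eq_bigr => i _; apply: eq_bigr => j _; ring.
under [X in _ = _ * X]eq_bigr do rewrite sumrB big_split /= -!mulr_sumr.
rewrite sumrB big_split /= -!mulr_suml -mulr_sumr -mulr_suml expr2.
by field.
Qed.

(** Hoelder's inequality with exponents 4/3 and 4, from two applications of
    [jensen_sqr] to A / v. *)
Lemma weighted_pow4_sum (I : finType) (v A : I -> R) : (forall i, 0 < v i) ->
  (\sum_i A i) ^+ 4 <= (\sum_i v i) ^+ 3 * \sum_i A i ^+ 4 / v i ^+ 3.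
Proof.
move=> v0; have v0' i : 0 <= v i by apply: ltW.
have V0 : 0 <= \sum_i v i by apply: sumr_ge0.
pose y i := A i / v i.
have -> : \sum_i A i = \sum_i v i * y i.
  by apply: eq_bigr => i _; rewrite /y mulrC divfK ?gt_eqF.
have -> : \sum_i A i ^+ 4 / v i ^+ 3 = \sum_i v i * (y i ^+ 2) ^+ 2.
  by apply: eq_bigr => i _; rewrite /y; field; rewrite gt_eqF.
rewrite -[4%N]/(2 * 2)%N exprM.
apply: (@le_trans _ _ (((\sum_i v i) * \sum_i v i * y i ^+ 2) ^+ 2)).
  rewrite ler_sqr ?nnegrE ?sqr_ge0 ?jensen_sqr // mulr_ge0 // sumr_ge0 // => i _.
  by rewrite mulr_ge0 ?sqr_ge0.
rewrite exprMn [leRHS](_ : _ = (\sum_i v i) ^+ 2 *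
  ((\sum_i v i) * \sum_i v i * (y i ^+ 2) ^+ 2)); last by ring.
by apply: ler_wpM2l; [exact: sqr_ge0 | exact: jensen_sqr].
Qed.

Definition theta (m k : nat) : R := pi * (k%:R / m%:R).

(** The weight used in Hoelder's inequality at the k-th root of unity.  Its
    fourth power is the decay in [orbit_bound_pow4], and it is concentrated on
    the O(sqrt n) values of k nearest to 0 modulo n + 1. *)
Definition hump (n k : nat) : R := (1 + n%:R * sin (theta n.+1 k) ^+ 2)^-1.

Lemma hump_gt0 n k : 0 < hump n k.
Proof. by rewrite invr_gt0 ltr_pwDl // mulr_ge0 ?sqr_ge0 ?ler0n. Qed.

(** Up to a constant, 1 / (1 + l^2 / n) in a form that telescopes. *)
Definition hump_majorant (n l : nat) : R :=
  2 * n%:R / (Num.sqrt n%:R + l%:R) ^+ 2.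

Lemma hump_majorant_ge0 n l : 0 <= hump_majorant n l.
Proof. by rewrite divr_ge0 ?sqr_ge0 ?mulr_ge0 ?ler0n. Qed.

Lemma hump_le_near (n l : nat) : (3 <= n)%N -> (0 < l)%N -> (l.*2 <= n.+1)%N ->
  hump n l <= hump_majorant n l.
Proof.
move=> n3 l0 ln; have := sin_sqr_lower R l0 ln; rewrite -/(theta _ _) => h.
have nR : 3 <= n%:R :> R by rewrite ler_nat.
have lR : 1 <= l%:R :> R by rewrite ler1n.
have r0 : 0 < Num.sqrt n%:R :> R by rewrite sqrtr_gt0; lra.
have rn : Num.sqrt n%:R ^+ 2 = n%:R :> R by rewrite sqr_sqrtr ?ler0n.
have h2 : l%:R ^+ 2 / n%:R <= n%:R * sin (theta n.+1 l) ^+ 2.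
  apply: (@le_trans _ _ (n%:R * (2 * (l%:R / n.+1%:R) ^+ 2))); last first.
    by rewrite ler_wpM2l ?ler0n.
  rewrite -[n.+1%:R]natr1.
  have -> : n%:R * (2 * (l%:R / (n%:R + 1)) ^+ 2) =
      l%:R ^+ 2 / n%:R * ((2 * n%:R ^+ 2) / (n%:R + 1) ^+ 2) :> R.
    by field; apply/andP; split; rewrite gt_eqF //; lra.
  rewrite ler_peMr ?divr_ge0 ?sqr_ge0 ?ler0n // ler_pdivlMr ?exprn_gt0; nra.
apply: (@le_trans _ _ (1 + l%:R ^+ 2 / n%:R)^-1).
  rewrite lef_pV2 ?posrE ?lerD2l //.
    by rewrite ltr_pwDl // mulr_ge0 ?sqr_ge0 ?ler0n.
  by rewrite ltr_pwDl // divr_ge0 ?sqr_ge0 ?ler0n.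
have -> : (1 + l%:R ^+ 2 / n%:R)^-1 = n%:R / (n%:R + l%:R ^+ 2) :> R.
  field; apply/andP; split; rewrite gt_eqF //; nra.
rewrite /hump_majorant; set r := Num.sqrt _ in r0 rn *.
rewrite ler_pdivrMr; last nra.
rewrite mulrAC ler_pdivlMr; last by rewrite exprn_gt0 //; lra.
rewrite -[X in _ <= X]mulrA [X in _ <= X]mulrCA ler_wpM2l ?ler0n // -rn.
have := sqr_ge0 (r - l%:R); nra.
Qed.

Lemma hump_sym (n k : nat) : (k <= n.+1)%N -> hump n (n.+1 - k) = hump n k.
Proof.
move=> kn; rewrite /hump /theta natrB //.
have E (M : R) : M != 0 -> pi * ((M - k%:R) / M) = - (pi * (k%:R / M)) + pi.
  by move=> M0; field.
by rewrite E ?pnatr_eq0 // sinDpi sinN opprK.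
Qed.

(** Comparison with the telescoping sum of 2 n / (sqrt n + l). *)
Lemma sum_hump_majorant (n : nat) : (0 < n)%N ->
  \sum_(1 <= l < n.+1) hump_majorant n l <= 2 * Num.sqrt n%:R.
Proof.
move=> n0; have nR : 1 <= n%:R :> R by rewrite ler1n.
have r0 : 0 < Num.sqrt n%:R :> R by rewrite sqrtr_gt0; lra.
have rn : Num.sqrt n%:R ^+ 2 = n%:R :> R by rewrite sqr_sqrtr ?ler0n.
rewrite /hump_majorant; set r := Num.sqrt _ in r0 rn *.
pose f l : R := - (2 * n%:R / (r + l%:R)).
rewrite big_add1 /=.
apply: (@le_trans _ _ (\sum_(0 <= l < n) (f l.+1 - f l))).
  apply: ler_sum => l _; rewrite /f -[l.+1%:R]natr1.
  have lR : 0 <= l%:R :> R by rewrite ler0n.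
  rewrite -subr_ge0.
  have -> : - (2 * n%:R / (r + (l%:R + 1))) - - (2 * n%:R / (r + l%:R)) -
     2 * n%:R / (r + (l%:R + 1)) ^+ 2 =
     2 * n%:R / ((r + (l%:R + 1)) ^+ 2 * (r + l%:R)).
    by field; apply/andP; split; rewrite gt_eqF //; lra.
  by rewrite divr_ge0 ?sqr_ge0 ?mulr_ge0 ?ler0n //; lra.
rewrite telescope_sumr // /f opprK addr0 -rn.
have -> : 2 * r ^+ 2 / r = 2 * r by field; rewrite gt_eqF.
rewrite gerDr oppr_le0 divr_ge0 //; last by rewrite addr_ge0 ?sqr_ge0 ?ltW.
by rewrite mulr_ge0 ?sqr_ge0.
Qed.

(** The bound [hump_le_near] holds only at the smaller l of k and n + 1 - k; as
    [hump] is symmetric and the majorant nonnegative, the sum of the majorants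
    at k and n + 1 - k bounds it for all k > 0. *)
Lemma sum_hump (n : nat) : (3 <= n)%N ->
  \sum_(k < n.+1) hump n k <= 5 * Num.sqrt n%:R.
Proof.
move=> n3; have nR : 3 <= n%:R :> R by rewrite ler_nat.
have r1 : 1 <= Num.sqrt n%:R :> R by rewrite -[leLHS]sqrtr1; apply: ler_wsqrtr; lra.
rewrite -(big_mkord xpredT (hump n)) big_ltn //.
have h0 : hump n 0 <= 1.
  by rewrite invf_le1 ?lerDl ?ltr_pwDl // mulr_ge0 ?sqr_ge0 ?ler0n.
suff : \sum_(1 <= k < n.+1) hump n k <=
    \sum_(1 <= k < n.+1) hump_majorant n k +
    \sum_(1 <= k < n.+1) hump_majorant n k.
  have := sum_hump_majorant (ltnW (ltnW n3)); lra.
rewrite [X in _ <= _ + X]big_nat_rev /= -big_split /= !big_nat.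
apply: ler_sum => k /andP[k1 kn].
have -> : (1 + n.+1 - k.+1 = n.+1 - k)%N by lia.
have [km|km] := leqP k.*2 n.+1.
  by rewrite (le_trans (hump_le_near n3 k1 km)) // lerDl hump_majorant_ge0.
rewrite -hump_sym ?(ltnW kn) //.
rewrite (le_trans (hump_le_near n3 (_ : 0 < n.+1 - k)%N _)) ?lerDr ?hump_majorant_ge0 // ?subn_gt0 //; lia.
Qed.

End Averages.

(** * Complex exponentials *)

Section Cis.
Local Open Scope complex_scope.
Variable R : realType.
Implicit Types x y : R.

Definition cis x : R[i] := cos x +i* sin x.

Lemma cis0 : cis 0 = 1. Proof. by rewrite /cis cos0 sin0. Qed.

Lemma cisD x y : cis (x + y) = cis x * cis y.
Proof. by rewrite /cis cosD sinD; congr (_ +i* _); rewrite addrC. Qed.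

Lemma cisX x (k : nat) : cis x ^+ k = cis (k%:R * x).
Proof.
elim: k => [|k IH]; first by rewrite mul0r cis0.
by rewrite exprS IH -cisD mulrSr mulrDl mul1r addrC.
Qed.

Lemma normc_1cis x : cmod (1 + cis (2 * x)) = 2 * `|cos x|.
Proof.
rewrite /ComplexField.Normc.normc /= add0r mulr_natl cos_mulr2n sin_mulr2n.
have -> : (1 + (cos x ^+ 2 *+ 2 - 1)) ^+ 2 + (cos x * sin x *+ 2) ^+ 2 =
   (2 * `|cos x|) ^+ 2.
  rewrite exprMn real_normK ?num_real //.
  transitivity (2 ^+ 2 * cos x ^+ 2 * (cos x ^+ 2 + sin x ^+ 2)); first by ring.
  by rewrite cos2Dsin2 mulr1.
by rewrite sqrtr_sqr ger0_norm // mulr_ge0.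
Qed.

Lemma cis_2pi_neq1 (m N : nat) : (0 < m < N)%N -> cis (2 * (pi * (m%:R / N%:R))) != 1.
Proof.
move=> /andP[m0 mN]; apply/eqP => /(congr1 (@complex.Re R)) /=.
rewrite mulr_natl cos_mulr2n; set a := pi * _.
have sa : 0 < sin a.
  have N0 : (0 < N)%N by apply: leq_ltn_trans mN.
  have NR : 0 < N%:R :> R by rewrite ltr0n.
  apply: sin_gt0_pi; rewrite /a mulr_gt0 ?pi_gt0 ?divr_gt0 ?ltr0n //=.
  by rewrite gtr_pMr ?pi_gt0 // ltr_pdivrMr // mul1r ltr_nat.
have s2 : 0 < sin a ^+ 2 by apply: exprn_gt0.
have := cos2Dsin2 a; lra.
Qed.

Lemma cis_prim (N : nat) : (0 < N)%N -> N.-primitive_root (cis (2 * (pi / N%:R))).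
Proof.
move=> N0; have NR : N%:R != 0 :> R by rewrite pnatr_eq0 -lt0n.
have uN : cis (2 * (pi / N%:R)) ^+ N = 1.
  rewrite cisX (_ : _ * _ = pi *+ 2); last by rewrite -mulr_natr; field.
  by rewrite /cis cos2pi sin2pi.
have [m m_prim mN] := prim_order_exists N0 uN.
have m0 := prim_order_gt0 m_prim.
suff Em : m = N by rewrite -{1}Em.
apply/eqP; rewrite eqn_leq (dvdn_leq _ mN) //= leqNgt; apply/negP => lt.
have /eqP[] : cis (2 * (pi * (m%:R / N%:R))) != 1 by apply: cis_2pi_neq1; rewrite m0.
rewrite -(prim_expr_order m_prim) cisX; congr cis; ring.
Qed.

Lemma cisN_prim (N : nat) : (0 < N)%N -> N.-primitive_root (cis (- (2 * (pi / N%:R)))).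
Proof.
move=> N0; have p := cis_prim N0.
have inv : cis (2 * (pi / N%:R)) * cis (- (2 * (pi / N%:R))) = 1.
  by rewrite -cisD subrr cis0.
have -> : cis (- (2 * (pi / N%:R))) = (cis (2 * (pi / N%:R))) ^+ N.-1.
  have c0 : cis (2 * (pi / N%:R)) != 0.
    by apply: contraTneq isT => c0; move/eqP: inv; rewrite c0 mul0r eq_sym oner_eq0.
  by apply: (mulfI c0); rewrite inv -exprS prednK ?(prim_expr_order p).
by rewrite (prim_root_exp_coprime _ p) -{2}(prednK N0) coprimenS.
Qed.

Lemma normcE_real (z : R[i]) : `|z| = (cmod z)%:C.
Proof. by []. Qed.

Lemma cexp_root (N x t : nat) :
  cexp (- ((2 * pi)%:C * 'i * x%:R * t%:R / N%:R)) =
  cis (- (2 * (pi / N%:R))) ^+ (x * t) :> R[i].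
Proof.
rewrite cisX.
have -> : - ((2 * pi)%:C * 'i * x%:R * t%:R / N%:R) =
    0 +i* ((x * t)%:R * - (2 * (pi / N%:R))) :> R[i].
  rewrite -!(rmorph_nat (real_complex R)) -fmorphV.
  rewrite natrM; simpc; congr (_ +i* _); ring.
by rewrite /cexp /= expR0 mul1r.
Qed.

End Cis.

(** * The weight classes *)

Section Modulus.
Local Open Scope complex_scope.

Lemma cmod_ge0 (R : rcfType) (x : R[i]) : 0 <= cmod x.
Proof. by case: x => a b; exact: sqrtr_ge0. Qed.

Lemma parseval_cmod (R : realType) (N : nat) (u : R[i]) (N_gt1 : (1 < N)%N)
  (u_prim : N.-primitive_root u) (f : 'Z_N -> R[i]) :
  \sum_(t : 'Z_N) cmod (\sum_x f x * u ^+ (x * t)) ^+ 2 =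
  N%:R * \sum_x cmod (f x) ^+ 2.
Proof.
apply: (@complexI R); rewrite rmorphM rmorph_nat !rmorph_sum.
under eq_bigr do rewrite rmorphXn /= -normcE_real.
by rewrite (parseval N_gt1 u_prim); congr (_ * _); apply: eq_bigr => x _; rewrite rmorphXn.
Qed.

Lemma fourth_moment_cmod (R : realType) (N : nat) (u : R[i]) (N_gt1 : (1 < N)%N)
  (u_prim : N.-primitive_root u) (A : {set 'Z_N}) :
  \sum_(t : 'Z_N) cmod (\sum_(x in A) u ^+ (x * t)) ^+ 4 = N%:R * (energy A)%:R.
Proof.
apply: (@complexI R); rewrite rmorphM !rmorph_nat rmorph_sum.
under eq_bigr do rewrite rmorphXn /= -normcE_real.
exact: (fourth_moment N_gt1 u_prim).
Qed.

End Modulus.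

Section WeightClass.
Local Open Scope complex_scope.
Variable R : realType.
Variable n : nat.
Hypothesis n_ge3 : (3 <= n)%N.

Local Notation N := (mersenne n).
Local Notation u := (cis (- (2 * (pi / N%:R))) : R[i]).
Local Notation z := (cis (2 * (pi / n.+1%:R)) : R[i]).

Let N_S : (2 ^ n = N.+1)%N.
Proof. by rewrite /mersenne subn1 prednK ?expn_gt0. Qed.

Let N_gt1 : (1 < N)%N.
Proof.
have : (2 ^ 3 <= 2 ^ n)%N by rewrite leq_exp2l.
by rewrite N_S ltnS; apply: leq_trans.
Qed.

Let N_gt0 : (0 < N)%N := ltnW N_gt1.
Let u_prim : N.-primitive_root u := cisN_prim R N_gt0.
Let z_prim : n.+1.-primitive_root z := cis_prim R (ltn0Sn n).

Let norm_zX k : `|z ^+ k| = 1.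
Proof.
have n1 : (1 < n.+1)%N by lia.
by rewrite normrX (norm_prim_root n1 z_prim) expr1n.
Qed.

Let cmod_zX k : cmod (z ^+ k) = 1.
Proof. by apply: (@complexI R); rewrite -normcE_real norm_zX. Qed.

Let NR : N%:R + 1 = 2 ^+ n :> R.
Proof. by rewrite natr1 -N_S natrX. Qed.

(** The strings of n digits represent every residue once, except that 0 is
    also represented by the string of ones, of value N. *)
Lemma sum_residues (V : nmodType) (f : nat -> V) :
  \sum_(x < 2 ^ n) f x = \sum_(x : Zmersenne n) f x + f N.
Proof.
rewrite N_S big_ord_recr /=; congr (_ + _).
by rewrite -!(big_mkord xpredT f) (Zp_cast N_gt1).
Qed.

Definition char_sum (w : nat) (t : Zmersenne n) : R[i] :=
  \sum_(x in weight_class n w) u ^+ (x * t).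

Lemma fourierE w t : fourier R (weight_class n w) t = N%:R^-1 * char_sum w t.
Proof. by congr (_ * _); apply: eq_bigr => x _; apply: cexp_root. Qed.

Definition generating (k : nat) (t : nat) : R[i] :=
  \prod_(j < n) (1 + z ^+ k * (u ^+ t) ^+ (2 ^ j)).

Lemma generatingE k t :
  generating k t = \sum_(x < 2 ^ n) z ^+ (k * wt n x) * u ^+ (x * t).
Proof.
rewrite /generating -sum_wt_pow; apply: eq_bigr => x _.
by rewrite -!exprM [(t * x)%N]mulnC.
Qed.

(** Averaging over the n + 1 roots of unity isolates the weight w modulo
    n + 1, hence exactly, as weights are at most n.  The second
    representative of 0 has weight n <> w and drops out. *)
Lemma char_sum_extract (w : nat) t : (w < n)%N ->
  n.+1%:R * char_sum w t =
  \sum_(k < n.+1) z ^+ (k * (n.+1 - w)) * generating k t.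
Proof.
move=> wn.
under eq_bigr => k _ do rewrite generatingE mulr_sumr.
rewrite exchange_big /=.
under eq_bigr => x _.
  under eq_bigr => k _.
    rewrite mulrA -exprD -mulnDr [(k * _)%N]mulnC.
    over.
  rewrite -mulr_suml (sum_prim_root_pow z_prim).
  over.
rewrite (sum_residues (fun x => (if (n.+1 %| n.+1 - w + wt n x)%N
  then n.+1%:R else 0) * u ^+ (x * t))) wt_mersenne ifF ?mul0r ?addr0; last first.
  apply/negP => /dvdnP[q]; case: q => [|[|q]]; lia.
rewrite /char_sum mulr_sumr [LHS]big_mkcond; apply: eq_bigr => x _ /=.
rewrite inE; have le := wt_le n x; case: eqP => [->|ne].
  by rewrite subnK ?dvdnn //; lia.
rewrite ifF ?mul0r //; apply/negP => /dvdnP[q]; case: q => [|[|q]]; lia.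
Qed.

(** The modulus of [generating], normalized by 2 ^+ n. *)
Definition amp (k t : nat) : R :=
  \prod_(j < n) `|cos (theta R n.+1 k - 2 ^+ j * (pi * (t%:R / N%:R)))|.

Lemma amp_ge0 k t : 0 <= amp k t.
Proof. by apply: prodr_ge0 => j _. Qed.

Lemma cmod_generating k t : cmod (generating k t) = 2 ^+ n * amp k t.
Proof.
apply: (@complexI R); rewrite -normcE_real normr_prod.
rewrite /amp -[X in 2 ^+ X]card_ord -prodr_const -big_split rmorph_prod /=.
apply: eq_bigr => j _; rewrite normcE_real -normc_1cis; congr ((cmod (1 + _))%:C).
rewrite -exprM !cisX -cisD; congr cis.
by rewrite natrM natrX /theta; ring.
Qed.

Lemma cmod_char_sum (w : nat) t : (w < n)%N ->
  n.+1%:R * cmod (char_sum w t) <= 2 ^+ n * \sum_(k < n.+1) amp k t.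
Proof.
move=> wn; rewrite -lecR rmorphM /= -normcE_real rmorph_nat -[n.+1%:R]normr_nat.
rewrite -normrM (char_sum_extract _ wn).
apply: (le_trans (ler_norm_sum _ _ _)).
rewrite mulr_sumr rmorph_sum; apply: ler_sum => k _.
by rewrite normrM norm_zX mul1r normcE_real cmod_generating.
Qed.

Lemma generating_split k (t : Zmersenne n) :
  generating k t =
  \sum_(x : Zmersenne n) z ^+ (k * wt n x) * u ^+ (x * t) + z ^+ (k * n).
Proof.
rewrite generatingE (sum_residues (fun x => z ^+ (k * wt n x) * u ^+ (x * t))).
rewrite wt_mersenne; congr (_ + _).
by rewrite [u ^+ _]exprM (prim_expr_order u_prim) expr1n mulr1.
Qed.

(** Up to the contribution of the string of ones, which has modulus 1,
    [generating] is the transform of a function of modulus 1 on the residues,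
    so Parseval applies. *)
Lemma sum_amp_sqr k : \sum_(t : Zmersenne n) amp k t ^+ 2 <= 2.
Proof.
have p2 : 0 < 2 ^+ n :> R by rewrite exprn_gt0.
rewrite -(ler_pM2l (exprn_gt0 2 p2)) mulr_sumr.
apply: (@le_trans _ _ (2 * N%:R * (N%:R + 1))); last first.
  by rewrite -NR; have : 0 <= N%:R :> R by []; nra.
under eq_bigr do rewrite -exprMn -cmod_generating.
pose H t := \sum_(x : Zmersenne n) z ^+ (k * wt n x) * u ^+ (x * t).
apply: (@le_trans _ _ (\sum_(t : Zmersenne n) (2 * cmod (H t) ^+ 2 + 2))).
  apply: ler_sum => t _; rewrite generating_split -/(H t).
  have h : cmod (H t + z ^+ (k * n)) <= cmod (H t) + cmod (z ^+ (k * n)).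
    by rewrite -lecR rmorphD /= -!normcE_real ler_normD.
  have h0 : 0 <= cmod (H t + z ^+ (k * n)) by apply: cmod_ge0.
  rewrite cmod_zX in h; have : 0 <= (cmod (H t) - 1) ^+ 2 by apply: sqr_ge0.
  set a := cmod (H t + _) in h h0 *; set b := cmod (H t) in h *.
  by nra.
rewrite big_split /= -mulr_sumr (parseval_cmod N_gt1 u_prim).
have card (a : R) : \sum_(x : Zmersenne n) a = a * N%:R.
  by rewrite sumr_const card_ord (Zp_cast N_gt1) mulr_natr.
rewrite [X in 2 * (N%:R * X)](_ : _ = N%:R); last first.
  transitivity (\sum_(x : Zmersenne n) (1 : R)); last by rewrite card mul1r.
  by apply: eq_bigr => x _; rewrite cmod_zX expr1n.
by rewrite card le_eqVlt; apply/orP; left; apply/eqP; ring.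
Qed.

(** The absolute constant of [orbit_bound_pow4]. *)
Definition ampK : R := expR 2 * 440 ^+ 2 * 100 ^+ 5.

Lemma ampK_gt0 : 0 < ampK.
Proof.
have p : 0 < 440 ^+ 2 * 100 ^+ 5 :> R by rewrite mulr_gt0 // exprn_gt0.
by rewrite /ampK -mulrA mulr_gt0 ?expR_gt0.
Qed.

Let n_gt0 : (0 < n)%N. Proof. lia. Qed.

(** [orbit_bound_pow4] for the angle a = pi t / N: as 2^n = N + 1, the n-th
    doubling of a is a + t pi. *)
Lemma amp_sqr_le k (t : Zmersenne n) : t != 0 ->
  amp k t ^+ 2 <= ampK / n%:R * hump R n k ^+ 4.
Proof.
move=> t0; have tpos : (0 < t)%N by rewrite lt0n.
have tN : (t < N)%N by rewrite -{2}(Zp_cast N_gt1).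
have N0 : 0 < N%:R :> R by rewrite ltr0n.
have sin0 : sin (pi * (t%:R / N%:R)) != 0 :> R.
  rewrite gt_eqF // sin_gt0_pi // mulr_gt0 ?pi_gt0 ?divr_gt0 ?ltr0n //=.
  by rewrite gtr_pMr ?pi_gt0 // ltr_pdivrMr // mul1r ltr_nat.
have periodic : 2 ^+ n * (pi * (t%:R / N%:R)) = pi * (t%:R / N%:R) + pi *+ t :> R.
  by rewrite -NR -mulr_natr; field; rewrite gt_eqF.
have := orbit_bound_pow4 (theta R n.+1 k) n_gt0 periodic sin0.
rewrite -exprVn -/(hump _ _ _) -/ampK /amp -prodrXl.
by under eq_bigr do rewrite real_normK ?num_real //.
Qed.

(** Of the four factors, two are estimated pointwise and two in mean square. *)
Lemma sum_amp_pow4 k :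
  \sum_(t : Zmersenne n | t != 0) amp k t ^+ 4 <= 2 * (ampK / n%:R * hump R n k ^+ 4).
Proof.
have h0 := hump_gt0 R n k; have K0 := ampK_gt0.
have c0 : 0 <= ampK / n%:R * hump R n k ^+ 4.
  by rewrite mulr_ge0 ?exprn_ge0 ?divr_ge0 ?ler0n // ltW.
apply: (@le_trans _ _ (\sum_(t : Zmersenne n | t != 0)
    amp k t ^+ 2 * (ampK / n%:R * hump R n k ^+ 4))).
  apply: ler_sum => t t0; rewrite -[4%N]/(2 + 2)%N exprD ler_wpM2l ?sqr_ge0 //.
  exact: amp_sqr_le.
rewrite -mulr_suml ler_wpM2r //; apply: le_trans (sum_amp_sqr k).
rewrite [leRHS](bigID (fun t => t != 0)) /= lerDl.
by apply: sumr_ge0 => t _; apply: sqr_ge0.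
Qed.

(** With v = [hump], Hoelder's factor v^-3 meets the bound v^4 and leaves a
    single v: the sum is O((sum v)^4 / n) = O(n). *)
Lemma sum_total_amp_pow4 :
  \sum_(t : Zmersenne n | t != 0) (\sum_(k < n.+1) amp k t) ^+ 4 <=
  2 * 5 ^+ 4 * ampK * n%:R.
Proof.
set V := \sum_(k < n.+1) hump R n k.
have nR : 0 < n%:R :> R by rewrite ltr0n.
have V0 : 0 <= V by apply: sumr_ge0 => k _; apply/ltW/hump_gt0.
have K0 := ampK_gt0.
apply: (@le_trans _ _ (\sum_(t : Zmersenne n | t != 0)
    V ^+ 3 * \sum_(k < n.+1) amp k t ^+ 4 / hump R n k ^+ 3)).
  apply: ler_sum => t _.
  by apply: weighted_pow4_sum => k; apply: hump_gt0.
rewrite -mulr_sumr exchange_big /=.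
apply: (@le_trans _ _ (V ^+ 3 * \sum_(k < n.+1) 2 * (ampK / n%:R) * hump R n k)).
  rewrite ler_wpM2l ?exprn_ge0 //; apply: ler_sum => k _.
  have h0 := hump_gt0 R n k.
  rewrite -mulr_suml ler_pdivrMr ?exprn_gt0 //; apply: (le_trans (sum_amp_pow4 k)).
  by rewrite le_eqVlt; apply/orP; left; apply/eqP; ring.
rewrite -mulr_sumr -/V.
have V4 : V ^+ 4 <= 5 ^+ 4 * n%:R ^+ 2.
  have -> : 5 ^+ 4 * n%:R ^+ 2 = (5 * Num.sqrt n%:R) ^+ 4 :> R.
    by rewrite exprMn; congr (_ * _); rewrite (exprM _ 2 2) sqr_sqrtr ?ler0n.
  by rewrite lerXn2r ?nnegrE ?mulr_ge0 ?sqrtr_ge0 // /V sum_hump.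
have -> : V ^+ 3 * (2 * (ampK / n%:R) * V) = 2 * (ampK / n%:R) * V ^+ 4 by ring.
apply: (@le_trans _ _ (2 * (ampK / n%:R) * (5 ^+ 4 * n%:R ^+ 2))).
  by rewrite ler_wpM2l // mulr_ge0 // divr_ge0 // ltW.
by rewrite le_eqVlt; apply/orP; left; apply/eqP; field; rewrite gt_eqF.
Qed.

Lemma sum_char_sum_pow4 (w : nat) : (w < n)%N ->
  \sum_(t : Zmersenne n | t != 0) cmod (char_sum w t) ^+ 4 <=
  2 * 10 ^+ 4 * ampK * (N%:R ^+ 4 * n%:R ^- 3).
Proof.
move=> wn; have nR : 1 <= n%:R :> R by rewrite ler1n.
have NR1 : 1 <= N%:R :> R by rewrite ler1n.
have K0 := ampK_gt0.
have m0 : 0 < n.+1%:R ^+ 4 :> R by rewrite exprn_gt0 // ltr0n.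
rewrite -(ler_pM2l m0) mulr_sumr.
apply: (@le_trans _ _ (\sum_(t : Zmersenne n | t != 0)
    (2 ^+ n) ^+ 4 * (\sum_(k < n.+1) amp k t) ^+ 4)).
  apply: ler_sum => t _; rewrite -!exprMn lerXn2r ?nnegrE ?cmod_char_sum //.
    by rewrite mulr_ge0 // cmod_ge0.
  by rewrite mulr_ge0 ?exprn_ge0 // sumr_ge0 // => k _; apply: amp_ge0.
rewrite -mulr_sumr.
apply: (@le_trans _ _ ((2 * N%:R) ^+ 4 * (2 * 5 ^+ 4 * ampK * n%:R))).
  apply: ler_pM; rewrite ?exprn_ge0 ?sumr_ge0 // ?sum_total_amp_pow4 //.
    by move=> t _; rewrite exprn_ge0 // sumr_ge0 // => k _; apply: amp_ge0.
  by rewrite lerXn2r ?nnegrE ?exprn_ge0 ?mulr_ge0 // -NR; lra.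
have -> : (2 * N%:R) ^+ 4 * (2 * 5 ^+ 4 * ampK * n%:R) =
    n%:R ^+ 4 * (2 * 10 ^+ 4 * ampK * (N%:R ^+ 4 * n%:R ^- 3)).
  by field; rewrite gt_eqF //; lra.
rewrite ler_wpM2r ?lerXn2r ?nnegrE ?ler0n ?ler_nat //.
apply: mulr_ge0; last by rewrite mulr_ge0 ?invr_ge0 ?exprn_ge0.
by apply: mulr_ge0; [rewrite mulr_ge0 // exprn_ge0 | exact: ltW].
Qed.

Lemma card_weight_class (w : nat) : (w < n)%N -> #|weight_class n w| = 'C(n, w).
Proof.
move=> wn; rewrite -card_wt (sum_residues (fun x => nat_of_bool (wt n x == w))).
rewrite wt_mersenne gtn_eqF // addr0 -sum1_card big_mkcond.
by apply: eq_bigr => x _; rewrite inE; case: (_ == _).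
Qed.

Lemma char_sum0 (w : nat) : (w < n)%N -> cmod (char_sum w 0) = ('C(n, w))%:R.
Proof.
move=> wn; apply: (@complexI R).
rewrite -normcE_real rmorph_nat /char_sum.
under eq_bigr do rewrite muln0 expr0.
by rewrite sumr_const card_weight_class // normr_nat.
Qed.

Lemma cmod_fourier_pow4 w t :
  cmod (fourier R (weight_class n w) t) ^+ 4 = N%:R ^- 4 * cmod (char_sum w t) ^+ 4.
Proof.
rewrite fourierE -exprVn -exprMn; congr (_ ^+ 4); apply: (@complexI R).
by rewrite -normcE_real normrM rmorphM fmorphV rmorph_nat /= -normcE_real normfV normr_nat.
Qed.

Lemma sum_fourier_pow4 (w : nat) : (w < n)%N ->
  \sum_(t : Zmersenne n | t != 0) cmod (fourier R (weight_class n w) t) ^+ 4 <=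
  2 * 10 ^+ 4 * ampK * n%:R ^- 3.
Proof.
move=> wn; have N0 : 0 < N%:R ^+ 4 :> R by rewrite exprn_gt0 // ltr0n.
under eq_bigr do rewrite cmod_fourier_pow4.
rewrite -mulr_sumr ler_pdivrMl //.
by apply: le_trans (sum_char_sum_pow4 wn) _; rewrite mulrCA.
Qed.

(** The term t = 0 of the fourth moment is the main term of the energy. *)
Lemma energy_deviation (w : nat) : (w < n)%N ->
  (energy (weight_class n w))%:R - N%:R^-1 * ('C(n, w))%:R ^+ 4 =
  N%:R ^+ 3 * \sum_(t : Zmersenne n | t != 0) cmod (fourier R (weight_class n w) t) ^+ 4.
Proof.
move=> wn; have NR1 : 1 <= N%:R :> R by rewrite ler1n.
have N0 : N%:R != 0 :> R by rewrite gt_eqF //; lra.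
under eq_bigr do rewrite cmod_fourier_pow4.
rewrite -mulr_sumr.
have := fourth_moment_cmod N_gt1 u_prim (weight_class n w).
rewrite (bigD1 0) //= -/(char_sum w 0) char_sum0 // => /(canLR (mulKf N0)) <-.
rewrite /char_sum; set S := \sum_(_ | _) _.
by field.
Qed.

End WeightClass.

Theorem theorem3 (R : realType) :
  (exists C : R, 0 < C /\
     forall (n : nat) (w : 'I_n), (3 <= n)%N ->
       \sum_(t : Zmersenne n | t != 0)
         cmod (fourier R (weight_class n w) t) ^+ 4
       <= C * n%:R ^- 3)
  /\
  (exists C : R, 0 < C /\
     forall (n : nat) (w : 'I_n), (3 <= n)%N ->
       `| (energy (weight_class n w))%:R
          - (mersenne n)%:R^-1 * ('C(n, w))%:R ^+ 4 |
       <= C * ((mersenne n)%:R ^+ 3 * n%:R ^- 3)).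
Proof.
have C0 : 0 < 2 * 10 ^+ 4 * ampK R by rewrite mulr_gt0 ?ampK_gt0 // mulr_gt0 ?exprn_gt0.
split; exists (2 * 10 ^+ 4 * ampK R); split=> // n w n3.
  exact: sum_fourier_pow4.
rewrite energy_deviation // ger0_norm; last first.
  by rewrite mulr_ge0 ?exprn_ge0 // sumr_ge0 // => t _; rewrite exprn_ge0 ?cmod_ge0.
by rewrite mulrCA; apply: ler_wpM2l; [rewrite exprn_ge0 | exact: sum_fourier_pow4].
Qed.
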